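(* The problem of computing a weak $(\operatorname{poly}\log n, \operatorname{poly}\log n)$-decomposition of a given $n$-node network graph $G$ is $\mathsf{P}\text{-}\mathsf{SLOCAL}$-complete, and likewise the problem of computing a strong $(\operatorname{poly}\log n, \operatorname{poly}\log n)$-decomposition of a given $n$-node network graph $G$ is $\mathsf{P}\text{-}\mathsf{SLOCAL}$-complete.
   Context: Distributed graph problems: the input graph $G=(V,E)$ with $n$ nodes is also the communication network; nodes have unique identifiers (of $O(\log n)$ bits) and possibly local inputs, and each node must produce a local output; the problem specifies which collections of outputs are valid. LOCAL model: computation proceeds in synchronous rounds; in each round every node performs arbitrary local computation, sends a message of arbitrary size to each neighbor and receives its neighbors' messages. $\mathsf{LOCAL}(t)$ is the class of problems solvable deterministically in $t$ rounds in this model. SLOCAL model: the nodes are processed sequentially in an arbitrary order. When a node $v$ is processed, it can read the current state of all nodes in its $r$-hop neighborhood (their initial inputs and everything stored by previously processed nodes), and computes its output as an arbitrary function of this; it may additionally store an arbitrary amount of information in its own state, readable by later processed nodes. The parameter $r$ is the locality. $\mathsf{SLOCAL}(t)$ is the class of problems solvable deterministically with locality $t$ in the SLOCAL model (correct for every processing order). $\mathsf{P}\text{-}\mathsf{LOCAL} := \mathsf{LOCAL}(\log^{O(1)} n)$ and $\mathsf{P}\text{-}\mathsf{SLOCAL} := \mathsf{SLOCAL}(\log^{O(1)} n)$. A problem $\mathcal{P}_1$ is polylog-reducible to $\mathcal{P}_2$ if a deterministic polylog-round LOCAL algorithm for $\mathcal{P}_2$ implies a deterministic polylog-round LOCAL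 algorithm for $\mathcal{P}_1$. A problem $\mathcal{P}$ is $\mathsf{P}\text{-}\mathsf{SLOCAL}$-complete if $\mathcal{P}\in\mathsf{P}\text{-}\mathsf{SLOCAL}$ and every problem in $\mathsf{P}\text{-}\mathsf{SLOCAL}$ is polylog-reducible to $\mathcal{P}$. Network decomposition: a weak (resp. strong) $(d(n),c(n))$-decomposition of an $n$-node graph $G=(V,E)$ is a partition of $V$ into clusters such that each cluster has weak (resp. strong) diameter at most $d(n)$ and the cluster graph is properly colored with colors $1,\dots,c(n)$. The weak diameter of a cluster $C$ is $\max_{u,v\in C}\operatorname{dist}_G(u,v)$; the strong diameter is the diameter of the induced subgraph $G[C]$. The cluster graph has the clusters as vertices, two clusters adjacent if some edge of $G$ joins them. *)

(* Defs.v *)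
From mathcomp Require Import all_boot.

Set Implicit Arguments.
Unset Strict Implicit.
Unset Printing Implicit Defensive.

Record sgraph := SGraph {
  vert :> finType;
  edge : rel vert;
  edge_sym : symmetric edge;
  edge_irr : irreflexive edge }.

(* dist_le e m u v: the distance from u to v in the graph e is at most m; it
   is false for every m when v is not reachable from u (infinite distance). *)
Definition dist_le (V : finType) (e : rel V) (m : nat) (u v : V) : bool :=
  [exists l : 'I_m.+1, exists p : l.-tuple V, path e u p && (last u p == v)].

Definition induced (V : finType) (e : rel V) (C : {set V}) : rel V :=
  [rel x y | [&& x \in C, y \in C & e x y]].

(* The rounding in trunc_log is absorbed by the exponent. *)
Definition polylog (f : nat -> nat) : Prop :=
  exists C N : nat, forall n, N <= n -> f n <= trunc_log 2 n ^ C.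

(* [valid] relates a graph and its local inputs to the admissible collections
   of local outputs; restrictions on inputs are expressed by accepting every
   output on the excluded ones. *)
Record problem := Problem {
  input : Type;
  output : Type;
  valid : forall G : sgraph, (G -> input) -> (G -> output) -> Prop }.

(* Unique identifiers of at most k * (bit length of n) bits: k is the constant
   of the "O(log n) bits" in the model. *)
Definition valid_ids (k : nat) (G : sgraph) (id : G -> nat) : Prop :=
  injective id /\ forall v, id v < 2 ^ (k * (trunc_log 2 #|vert G|).+1).

(* In the LOCAL model, a node initially knows n, its identifier and its input.
   Neighbors are addressed by identifier: [l_send s i] is the message sent in
   state s to the neighbor with identifier i (if there is one), and a node
   receives the partial map from identifiers of neighbors to messages. *)

Record local_alg (I O : Type) := LocalAlg {
  l_state : Type;
  l_msg : Type;
  l_init : nat -> nat -> I -> l_state;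
  l_send : l_state -> nat -> l_msg;
  l_recv : l_state -> (nat -> option l_msg) -> l_state;
  l_out : l_state -> O }.

Section LocalRun.
Variables (I O : Type) (A : local_alg I O) (G : sgraph).
Variables (id : G -> nat) (inp : G -> I).

Definition local_inbox (st : G -> l_state A) (v : G) (i : nat) :
    option (l_msg A) :=
  omap (fun u => l_send (st u) (id v)) [pick u : G | edge v u && (id u == i)].

Definition local_round (st : G -> l_state A) : G -> l_state A :=
  fun v => l_recv (st v) (local_inbox st v).

Definition local_start : G -> l_state A :=
  fun v => l_init A #|vert G| (id v) (inp v).

Definition local_run (t : nat) (v : G) : O :=
  l_out (iter t local_round local_start v).

End LocalRun.

Definition LOCAL (k : nat) (t : nat -> nat) (P : problem) : Prop :=
  exists A : local_alg (input P) (output P),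
    forall (G : sgraph) (id : G -> nat), valid_ids k id ->
    forall inp : G -> input P,
      valid inp (local_run A id inp (t #|vert G|)).

Definition PLOCAL (k : nat) (P : problem) : Prop :=
  exists t : nat -> nat, polylog t /\ LOCAL k t P.

(* In the SLOCAL model, the view of a node is described through identifiers
   only, so that an algorithm has no access to the names of the elements of
   the vertex type (which would act as a second set of identifiers). *)

Record sview (I S : Type) := SView {
  sv_self : nat;
  sv_node : nat -> option (I * option S);
  sv_edge : rel nat }.

Record slocal_alg (I O : Type) := SlocalAlg {
  s_state : Type;
  s_step : nat -> sview I (O * s_state) -> O * s_state }.

Section SlocalRun.
Variables (I O : Type) (A : slocal_alg I O) (G : sgraph).
Variables (id : G -> nat) (inp : G -> I) (r : nat).

(* None for a node that has not been processed yet. *)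
Definition smemory := G -> option (O * s_state A).

Definition ball_node (v : G) (i : nat) : option G :=
  [pick u : G | dist_le (@edge G) r v u && (id u == i)].

Definition slocal_view (mem : smemory) (v : G) : sview I (O * s_state A) :=
  SView (id v)
    (fun i => omap (fun u => (inp u, mem u)) (ball_node v i))
    (fun i j => if (ball_node v i, ball_node v j) is (Some u, Some w)
                then edge u w else false).

Definition slocal_process (mem : smemory) (v : G) : smemory :=
  fun u => if u == v then Some (s_step (s := A) #|vert G| (slocal_view mem v))
           else mem u.

Definition slocal_run (order : seq G) : smemory :=
  foldl slocal_process (fun _ => None) order.

End SlocalRun.

Definition SLOCAL (k : nat) (r : nat -> nat) (P : problem) : Prop :=
  exists A : slocal_alg (input P) (output P),
    forall (G : sgraph) (id : G -> nat), valid_ids k id ->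
    forall (inp : G -> input P) (order : seq G), perm_eq order (enum G) ->
      exists out : G -> output P,
        (forall v, omap fst (slocal_run A id inp (r #|vert G|) order v)
                   = Some (out v))
        /\ valid inp out.

Definition PSLOCAL (k : nat) (P : problem) : Prop :=
  exists r : nat -> nat, polylog r /\ SLOCAL k r P.

Definition polylog_reducible (k : nat) (P1 P2 : problem) : Prop :=
  PLOCAL k P2 -> PLOCAL k P1.

Definition PSLOCAL_hard (k : nat) (P : problem) : Prop :=
  forall Q : problem, PSLOCAL k Q -> polylog_reducible k Q P.

Definition PSLOCAL_complete (k : nat) (P : problem) : Prop :=
  PSLOCAL k P /\ PSLOCAL_hard k P.

Definition weak_diam_le (G : sgraph) (C : {set G}) (d : nat) : Prop :=
  {in C &, forall u v, dist_le (@edge G) d u v}.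

Definition strong_diam_le (G : sgraph) (C : {set G}) (d : nat) : Prop :=
  {in C &, forall u v, dist_le (induced (@edge G) C) d u v}.

Definition cluster_adj (G : sgraph) (C D : {set G}) : Prop :=
  C != D /\ exists u v, [/\ u \in C, v \in D & edge u v].

Definition is_decomposition
    (diam_le : forall G : sgraph, {set G} -> nat -> Prop) (d c : nat)
    (G : sgraph) (P : {set {set G}}) (col : {set G} -> nat) : Prop :=
  [/\ partition P [set: G],
      {in P, forall C, diam_le G C d},
      {in P, forall C, 0 < col C <= c}
    & {in P &, forall C D, cluster_adj C D -> col C <> col D}].

(* A node outputs a pair (name of its cluster, color of its cluster). *)
Definition represents (G : sgraph) (P : {set {set G}}) (col : {set G} -> nat)
    (out : G -> nat * nat) : Prop :=
  (forall u v, (out u).1 = (out v).1 <-> pblock P u = pblock P v)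
  /\ (forall v, (out v).2 = col (pblock P v)).

Definition decomposition_problem
    (diam_le : forall G : sgraph, {set G} -> nat -> Prop)
    (d c : nat -> nat) : problem :=
  {| input := unit;
     output := (nat * nat)%type;
     valid := fun G _ out => exists P col,
       is_decomposition diam_le (d #|vert G|) (c #|vert G|) P col
       /\ represents P col out |}.

Definition weak_decomposition := decomposition_problem weak_diam_le.
Definition strong_decomposition := decomposition_problem strong_diam_le.

(* Main.v *)
(** Hardness.  Run the given decomposition algorithm on the power graph G^r,
    where r is the locality of the SLOCAL algorithm, and process the nodes in
    the order of (color, identifier).  A node then depends only on nodes of its
    own cluster or of smaller colors, so its output is determined by its view
    at distance O(c d r) plus the view needed for the decomposition.  Since a
    LOCAL algorithm may collect that whole view, it can answer what the
    sequential run yields on any instance that has this view.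

    Membership.  Ball growing: a waiting node u of level j grows a ball among
    the waiting nodes of level j until one more step does not double it; the
    ball becomes a cluster of color j and its boundary moves on to level j+1.
    At most half of the nodes of a level move on, so logarithmically many levels
    suffice.  A processed node v settles itself by carving all levels in turn,
    in balls around v of decreasing radius, and stores the result. *)

Require Import Defs.
From mathcomp Require Import all_boot zify.
From Stdlib Require Import FunctionalExtensionality ClassicalEpsilon.

Set Implicit Arguments.
Unset Strict Implicit.
Unset Printing Implicit Defensive.

(** * Distances as bounded walks *)

Lemma dist_leP (V : finType) (e : rel V) m (u v : V) :
  reflect (exists p, [/\ path e u p, last u p = v & size p <= m])
          (dist_le e m u v).
Proof.
apply: (iffP existsP) => [[l /existsP[p /andP[up /eqP pv]]]|[p [up pv sz]]].
  by exists p; split=> //; rewrite size_tuple -ltnS.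
have lt : size p < m.+1 by [].
exists (Ordinal lt); apply/existsP; exists (in_tuple p).
by rewrite up pv eqxx.
Qed.

Lemma dist_le_refl (V : finType) (e : rel V) m (u : V) : dist_le e m u u.
Proof. by apply/dist_leP; exists [::]. Qed.

Lemma dist_le_edge (V : finType) (e : rel V) (u v : V) :
  e u v -> dist_le e 1 u v.
Proof. by move=> uv; apply/dist_leP; exists [:: v]; rewrite /= uv. Qed.

Lemma dist_le_trans (V : finType) (e : rel V) m m' (u v w : V) :
  dist_le e m u v -> dist_le e m' v w -> dist_le e (m + m') u w.
Proof.
move=> /dist_leP[p [up pv sp]] /dist_leP[q [vq qw sq]].
apply/dist_leP; exists (p ++ q); rewrite cat_path last_cat up pv vq size_cat.
by split=> //; apply: leq_add.
Qed.

Lemma dist_le_mono (V : finType) (e e' : rel V) m m' (u v : V) :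
  subrel e e' -> m <= m' -> dist_le e m u v -> dist_le e' m' u v.
Proof.
move=> ee' mm' /dist_leP[p [up pv sp]]; apply/dist_leP; exists p; split=> //.
  exact: sub_path up.
exact: leq_trans mm'.
Qed.

Lemma dist_le_leq (V : finType) (e : rel V) m m' (u v : V) :
  m <= m' -> dist_le e m u v -> dist_le e m' u v.
Proof. exact: dist_le_mono. Qed.

Lemma dist_le0 (V : finType) (e : rel V) (u v : V) : dist_le e 0 u v -> u = v.
Proof. by case/dist_leP=> -[|x p] [] //= _ ->. Qed.

Lemma dist_leS (V : finType) (e : rel V) m (u v : V) :
  dist_le e m.+1 u v -> u = v \/ exists2 w, e u w & dist_le e m w v.
Proof.
case/dist_leP=> -[|x p] /= [up pv sp]; first by left.
right; case/andP: up => ux xp; exists x => //.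
by apply/dist_leP; exists p.
Qed.

Lemma dist_le_sym (V : finType) (e : rel V) m (u v : V) :
  symmetric e -> dist_le e m u v = dist_le e m v u.
Proof.
move=> es; suff imp x y : dist_le e m x y -> dist_le e m y x.
  by apply/idP/idP; apply: imp.
elim: m x y => [|m IH] x y; first by move/dist_le0 ->; apply: dist_le_refl.
case/dist_leS=> [->|[z xz /IH zy]]; first exact: dist_le_refl.
by rewrite -addn1; apply: dist_le_trans zy _; apply: dist_le_edge; rewrite es.
Qed.

(** * Closure properties of polylogarithmic bounds *)

Lemma polylog_le f g : (forall n, f n <= g n) -> polylog g -> polylog f.
Proof.
by move=> fg [C [N gC]]; exists C, N => n /gC; apply: leq_trans.
Qed.

Lemma polylog_log : polylog (trunc_log 2).
Proof. by exists 1, 0. Qed.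

Lemma polylog_const c : polylog (fun=> c).
Proof.
exists 1, (2 ^ c) => n cn; rewrite expn1 trunc_log_max //.
Qed.

Lemma polylogM f g : polylog f -> polylog g -> polylog (fun n => f n * g n).
Proof.
move=> [C [N fC]] [C' [N' gC]]; exists (C + C'), (maxn N N') => n.
by rewrite geq_max => /andP[/fC h /gC h']; rewrite expnD leq_mul.
Qed.

Lemma polylogD f g : polylog f -> polylog g -> polylog (fun n => f n + g n).
Proof.
(* From 4 on the logarithm is at least 2, so one more power absorbs the factor 2 that the sum
   produces. *)
move=> [C [N fC]] [C' [N' gC]]; exists (maxn C C').+1, (maxn 4 (maxn N N')) => n.
rewrite !geq_max => /and3P[n4 /fC h /gC h'].
have l2 : 2 <= trunc_log 2 n by apply: trunc_log_max.
have l0 : 0 < trunc_log 2 n by apply: leq_trans l2.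
apply: (@leq_trans (trunc_log 2 n ^ maxn C C' + trunc_log 2 n ^ maxn C C')).
  by apply: leq_add; [apply: leq_trans h _|apply: leq_trans h' _];
     rewrite leq_pexp2l ?leq_maxl ?leq_maxr.
by rewrite addnn -mul2n expnS leq_mul2r l2 orbT.
Qed.

(** * From decompositions to sequential algorithms *)

(** Instances are bundled so that nodes of two different ones can be compared. The size bound on
    identifiers is imposed separately. *)
Record network (I : Type) := Network {
  net_graph :> sgraph;
  net_id : net_graph -> nat;
  net_inp : net_graph -> I;
  net_inj : injective net_id }.

(* Indistinguishability of [v] and [v'] after [t] rounds of communication. *)
Fixpoint sim (I : Type) (X X' : network I) (t : nat) (v : X) (v' : X') : Prop :=
  if t is s.+1 then
    [/\ sim s v v',
        forall u, edge v u -> exists2 u', edge v' u' & sim s u u'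
      & forall u', edge v' u' -> exists2 u, edge v u & sim s u u']
  else [/\ #|X| = #|X'|, net_id v = net_id v' & net_inp v = net_inp v'].

Section Sim.
Variable I : Type.
Implicit Types X Y : network I.

Lemma sim_sym X Y t (v : X) (w : Y) : sim t v w -> sim t w v.
Proof.
elim: t v w => [|t IH] v w /=; first by case=> -> -> ->.
case=> /IH wv vw' wv'; split=> // u.
  by case/wv'=> u' e /IH; exists u'.
by case/vw'=> u' e /IH; exists u'.
Qed.

Lemma sim_leq X Y s t (v : X) (w : Y) : s <= t -> sim t v w -> sim s v w.
Proof.
elim: t => [|t IH]; first by rewrite leqn0 => /eqP->.
by rewrite leq_eqVlt => /orP[/eqP-> //|/IH h [/h]].
Qed.

Lemma sim0 X Y t (v : X) (w : Y) : sim t v w ->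
  [/\ #|X| = #|Y|, net_id v = net_id w & net_inp v = net_inp w].
Proof. exact: (sim_leq (leq0n t)). Qed.

(** A walk is copied edge by edge, and each edge uses up one round of similarity. *)
Lemma sim_dist X Y m t (v u : X) (w : Y) :
  dist_le (@edge X) m v u -> sim (m + t) v w ->
  exists2 u', dist_le (@edge Y) m w u' & sim t u u'.
Proof.
elim: m v w => [|m IH] v w.
  by move/dist_le0 <- => vw; exists w => //; apply: dist_le_refl.
case/dist_leS=> [<- vw|[x vx xu]].
  by exists w; [apply: dist_le_refl|apply: sim_leq vw; lia].
rewrite addSn => -[_ /(_ _ vx)[x' wx' /(IH _ _ xu)[u' xu' uu'] _]].
exists u' => //; rewrite -add1n.
by apply: dist_le_trans xu'; apply: dist_le_edge.
Qed.

Lemma sim_dist_id X Y m t (v u : X) (w x : Y) :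
  net_id u = net_id x -> dist_le (@edge X) m v u -> sim (m + t) v w ->
  dist_le (@edge Y) m w x /\ sim t u x.
Proof.
move=> ux vu /(sim_dist vu)[u' wu' uu'].
suff <- : u' = x by [].
by case: (sim0 uu') => _ e _; apply: (@net_inj _ Y); rewrite -e.
Qed.

(** One round reveals the identifiers of the neighbors, and injectivity turns equal identifiers into
    equal nodes. *)
Lemma sim_edge X Y t (v u : X) (w x : Y) :
  sim t.+1 v w -> net_id u = net_id x -> edge v u = edge w x.
Proof.
have imp X' Y' (v' u' : X') (w' x' : Y') :
    sim t.+1 v' w' -> net_id u' = net_id x' -> edge v' u' -> edge w' x'.
  case=> _ h _ ux /h[y wy /sim0[_ e _]].
  suff <- : y = x' by [].
  by apply: (@net_inj _ Y'); rewrite -e.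
move=> vw ux; apply/idP/idP; first exact: imp vw ux.
by apply: imp (sim_sym vw) _.
Qed.

End Sim.

(** * Power graphs *)

Section PowerGraph.
Variables (G : sgraph) (r : nat).

Definition power_edge : rel G :=
  fun u v => (u != v) && dist_le (@edge G) r u v.

Lemma power_edge_sym : symmetric power_edge.
Proof.
by move=> u v; rewrite /power_edge eq_sym dist_le_sym //; apply: edge_sym.
Qed.

Lemma power_edge_irr : irreflexive power_edge.
Proof. by move=> u; rewrite /power_edge eqxx. Qed.

Definition power_graph : sgraph := SGraph power_edge_sym power_edge_irr.

Lemma dist_le_power d (u v : G) :
  dist_le (@edge power_graph) d u v -> dist_le (@edge G) (d * r) u v.
Proof.
elim: d u => [|d IH] u; first by move/dist_le0 ->; apply: dist_le_refl.
case/dist_leS=> [->|[w /andP[_ uw] /IH wv]]; first exact: dist_le_refl.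
by rewrite mulSn; apply: dist_le_trans uw wv.
Qed.

End PowerGraph.

Definition power_network (I : Type) (X : network I) (r : nat) : network unit :=
  @Network unit (power_graph X r) (@net_id I X) (fun=> tt) (@net_inj I X).

(** A round on the power graph is simulated by [r] rounds on the graph itself. *)
Lemma sim_power (I : Type) (X Y : network I) r t (v : X) (w : Y) :
  sim (r * t) v w -> @sim _ (power_network X r) (power_network Y r) t v w.
Proof.
elim: t v w => [|t IH] v w; first by case/sim0=> ? ? _.
move=> vw; split.
- by apply: IH; apply: sim_leq vw; rewrite leq_mul2l leqnSn orbT.
- move=> u /andP[vu d].
  rewrite mulnS in vw; case: (sim_dist d vw) => u' d' uu'.
  exists u'; last exact: IH.
  apply/andP; split=> //; apply: contraNneq vu => e.
  apply/eqP/(@net_inj _ X); case: (sim0 vw) (sim0 uu') => _ -> _ [_ -> _].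
  by rewrite e.
- move=> u /andP[vu d].
  rewrite mulnS in vw; case: (sim_dist d (sim_sym vw)) => u' d' uu'.
  exists u'; last by apply: IH; apply: sim_sym.
  apply/andP; split=> //; apply: contraNneq vu => e.
  apply/eqP/(@net_inj _ Y); case: (sim0 vw) (sim0 uu') => _ <- _ [_ -> _].
  by rewrite e.
Qed.

(** * LOCAL runs and full information *)

Definition net_rounds (I O : Type) (A : local_alg I O) (X : network I) (t : nat)
    : X -> l_state A :=
  iter t (local_round (@net_id I X)) (local_start A (@net_id I X) (@net_inp I X)).

(** Inboxes are indexed by identifiers, so matching neighbors fill the same slots with, by
    induction, the same messages. *)
Lemma sim_rounds (I O : Type) (A : local_alg I O) (X Y : network I) t
    (v : X) (w : Y) :
  sim t v w -> net_rounds A t v = net_rounds A t w.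
Proof.
elim: t v w => [|t IH] v w.
  by case=> n_eq id_eq inp_eq; rewrite /net_rounds /= /local_start n_eq id_eq inp_eq.
move=> vw; have vw_t : sim t v w := sim_leq (leqnSn t) vw.
rewrite /net_rounds !iterS /local_round -!/(net_rounds A t _) (IH _ _ vw_t).
congr (l_recv _ _); apply: functional_extensionality => i.
rewrite /local_inbox; case: (sim0 vw) => _ vw_id _.
case: pickP => [u /andP[vu /eqP u_i]|no].
  case: vw => _ /(_ _ vu)[x wx ux] _.
  case: pickP => [y /andP[wy /eqP y_i]|/(_ x)]; last first.
    by case: (sim0 ux) => _ <- _; rewrite wx u_i eqxx.
  rewrite /= vw_id -!/(net_rounds A t _); congr (Some (l_send _ _)); apply: IH.
  suff <- : x = y by [].
  by apply: (@net_inj _ Y); case: (sim0 ux) => _ <- _; rewrite u_i y_i.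
case: pickP => // y /andP[wy /eqP y_i].
case: vw => _ _ /(_ _ wy)[u vu /sim0[_ uy _]].
by move: (no u); rewrite vu uy y_i eqxx.
Qed.

(** The state of an algorithm that forwards all it knows; a transcript is the whole view of a node
    as a tree. *)
Inductive transcript (I : Type) : Type :=
| Start of nat & nat & I
| Round of transcript I & (nat -> option (transcript I)).

Definition full_info (I O : Type) (f : transcript I -> O) : local_alg I O :=
  {| l_state := transcript I;
     l_msg := transcript I;
     l_init := @Start I;
     l_send := fun s _ => s;
     l_recv := @Round I;
     l_out := f |}.

Fixpoint graph_size (I : Type) (s : transcript I) : nat :=
  match s with Start n _ _ => n | Round s' _ => graph_size s' end.

Lemma graph_size_rounds (I O : Type) (f : transcript I -> O) (X : network I) t
    (v : X) :
  graph_size (net_rounds (full_info f) t v) = #|X|.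
Proof. by elim: t v => //= t IH v; apply: IH. Qed.

(** Converse of [sim_rounds] for full information: transcripts are built by injective constructors,
    so equal ones can be taken apart round by round. *)
Lemma transcript_sim (I O : Type) (f : transcript I -> O) (X Y : network I) t
    (v : X) (w : Y) :
  net_rounds (full_info f) t v = net_rounds (full_info f) t w -> sim t v w.
Proof.
elim: t v w => [|t IH] v w; first by case.
rewrite /net_rounds !iterS /local_round -!/(net_rounds (full_info f) t _).
case=> /IH vw inbox.
have {}inbox i : local_inbox (@net_id _ X) (net_rounds (full_info f) t) v i =
    local_inbox (@net_id _ Y) (net_rounds (full_info f) t) w i.
  by rewrite inbox.
split=> // u.
  move=> vu; move: (inbox (net_id u)); rewrite /local_inbox.
  case: pickP => [u1 /andP[_ /eqP/(@net_inj _ X)->]|/(_ u)]; last by rewrite vu eqxx.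
  by case: pickP => [u' /andP[wu' _] [/IH]|//]; exists u'.
move=> wu; move: (inbox (net_id u)); rewrite /local_inbox.
case: (pickP (fun u1 => edge w u1 && _)) => [u1 /andP[_ /eqP/(@net_inj _ Y)->]|/(_ u)];
  last by rewrite wu eqxx.
by case: pickP => [u' /andP[vu' _] [/IH]|//]; exists u'.
Qed.

(** * Sequential runs as recursion on keys *)

Section SlocalByKey.
Variables (I O : Type) (S : slocal_alg I O) (X : network I) (r : nat).
Variable (key : X -> nat).

Let run := @slocal_run _ _ S X (@net_id I X) (@net_inp I X) r.
Let step (mem : smemory S X) (v : X) :=
  s_step (s := S) #|X| (slocal_view (@net_id I X) (@net_inp I X) r mem v).

(** When a node is processed, the memory is the final one masked to smaller keys. This turns the
    fold into a recursive equation that no longer mentions the list. *)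
Lemma slocal_run_pairwise (s : seq X) :
  pairwise (relpre key ltn) s ->
  (forall v, v \notin s -> run s v = None) /\
  (forall v, v \in s ->
    run s v = Some (step (fun u => if key u < key v then run s u else None) v)).
Proof.
elim/last_ind: s => [|s x IH]; first by [].
rewrite pairwise_rcons => /andP[/allP ltx /IH [out_s in_s]].
have runE u : run (rcons s x) u = if u == x then Some (step (run s) x) else run s u.
  by rewrite /run /slocal_run foldl_rcons.
have xs : x \notin s by apply/negP => /ltx /=; rewrite ltnn.
split=> v; rewrite mem_rcons inE.
  by rewrite negb_or runE => /andP[/negbTE->]; apply: out_s.
case: eqP => [-> _|_ /= vs].
  rewrite runE eqxx; congr (Some (step _ _)).
  apply: functional_extensionality => u; rewrite runE.
  case: eqP => [->|_]; first by rewrite ltnn out_s.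
  case: (boolP (u \in s)) => [/ltx /= ->//|/out_s->].
  by case: ifP.
have vx : (v == x) = false by apply: contraNF xs => /eqP <-.
rewrite runE vx in_s //; congr (Some (step _ _)).
apply: functional_extensionality => u; rewrite runE.
case: eqP => [->|//]; move: (ltx v vs) => /= h.
by rewrite ltnNge (ltnW h).
Qed.

Definition by_key : seq X := sort (relpre key leq) (enum X).

Definition run_by_key : smemory S X := run by_key.

Lemma run_by_keyE (key_inj : injective key) (v : X) :
  run_by_key v =
  Some (step (fun u => if key u < key v then run_by_key u else None) v).
Proof.
have tot : total (relpre key leq) by move=> x y; apply: leq_total.
have srt : pairwise (relpre key ltn) by_key.
  rewrite -sorted_pairwise; last by move=> y x z /=; apply: ltn_trans.
  rewrite -sorted_map ltn_sorted_uniq_leq.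
  by rewrite map_inj_uniq // sort_uniq enum_uniq sorted_map sort_sorted.
by have [_] := slocal_run_pairwise srt; apply; rewrite mem_sort mem_enum.
Qed.

End SlocalByKey.

(** The round beyond [r] is spent on edges between two nodes on the rim of the ball. *)
Lemma sim_slocal_view (I S : Type) (A : slocal_alg I S) (X Y : network I) r
    (mem : smemory A X) (mem' : smemory A Y) (v : X) (w : Y) :
  sim r.+1 v w ->
  (forall u u', net_id u = net_id u' -> dist_le (@edge X) r v u ->
     mem u = mem' u') ->
  slocal_view (@net_id _ X) (@net_inp _ X) r mem v =
  slocal_view (@net_id _ Y) (@net_inp _ Y) r mem' w.
Proof.
rewrite -addn1 => vw memE.
(* Both balls contain the same identifiers, and nodes with equal identifiers are still similar for
   one round. *)
have ballE i : (match ball_node (@net_id _ X) r v i, ball_node (@net_id _ Y) r w i with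
    | Some u, Some u' => [/\ net_id u = net_id u', dist_le (@edge X) r v u & sim 1 u u']
    | None, None => True
    | _, _ => False end : Prop).
  rewrite /ball_node; case: pickP => [u /andP[vu /eqP u_i]|no].
    have [x wx ux] := sim_dist vu vw.
    case: pickP => [y /andP[wy /eqP y_i]|/(_ x)].
      have uy : net_id u = net_id y by rewrite u_i.
      by split=> //; case: (sim_dist_id uy vu vw).
    by case: (sim0 ux) => _ <- _; rewrite wx u_i eqxx.
  case: pickP => [y /andP[wy /eqP y_i]|//].
  have [u vu /sim0[_ uy _]] := sim_dist wy (sim_sym vw).
  by move: (no u); rewrite vu -uy y_i eqxx.
rewrite /slocal_view; congr SView.
- by case: (sim0 vw).
- apply: functional_extensionality => i; move: (ballE i).
  case: (ball_node _ _ v i) => [u|]; case: (ball_node _ _ w i) => [u'|] //.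
  by case=> e d /sim0[_ _ inp_e]; rewrite /= inp_e (memE _ _ e d).
- apply: functional_extensionality => i; apply: functional_extensionality => j.
  move: (ballE i) (ballE j).
  case: (ball_node _ _ v i) => [u|]; case: (ball_node _ _ w i) => [u'|] //.
  case: (ball_node _ _ v j) => [x|]; case: (ball_node _ _ w j) => [x'|] //.
  by case=> _ _ uu' [xx' _ _]; apply: sim_edge uu' xx'.
Qed.

(** * Locality of the run ordered by color and identifier *)

Section Locality.
Variables (I O : Type) (S : slocal_alg I O) (r d M rho : nat).

(** The lexicographic order on (color, identifier) as one number, for identifiers below [M]. *)
Definition color_key (X : network I) (out : X -> nat * nat) (u : X) : nat :=
  (out u).2 * M + net_id u.

(* What a weak decomposition of the power graph of exponent [r] says about
   distances in the graph itself. *)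
Definition separated (X : network I) (out : X -> nat * nat) : Prop :=
  (forall u w, (out u).1 = (out w).1 ->
     dist_le (@edge X) (d * r) u w /\ (out u).2 = (out w).2) /\
  (forall u w, dist_le (@edge X) r u w ->
     (out u).1 = (out w).1 \/ (out u).2 <> (out w).2).

(** Each color costs the crossing of a cluster, [d * r], and one sequential view, [r]. The remaining
    [rho.+1] rounds fix the colors and leave the extra round that comparing views takes. *)
Definition color_radius (i : nat) : nat := i * (d * r + r) + rho.+1.

Lemma color_key_inj (X : network I) out :
  (forall u : X, net_id u < M) -> injective (color_key (X := X) out).
Proof.
move=> idM u w /(congr1 (modn^~ M)); rewrite !modnMDl !modn_small //.
exact: (@net_inj _ X).
Qed.

Lemma color_key_leq (X : network I) out (u w : X) :
  (forall u : X, net_id u < M) -> color_key out u < color_key out w ->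
  (out u).2 <= (out w).2.
Proof.
move=> idM; apply: contraTT; rewrite -ltnNge -leqNgt => lt.
apply: (@leq_trans ((out w).2.+1 * M)); last first.
  by rewrite (leq_trans _ (leq_addr _ _)) // leq_mul2r lt orbT.
by rewrite mulSnr leq_add2l ltnW.
Qed.

(** Outer induction on the color, inner induction on the key inside one cluster. *)
Lemma run_by_key_local (X Y : network I) outX outY i (v : X) (w : Y) :
  (forall u : X, net_id u < M) -> (forall u : Y, net_id u < M) ->
  separated outX -> separated outY ->
  (forall (u : X) (u' : Y), sim rho u u' -> outX u = outY u') ->
  (outX v).2 < i -> sim (color_radius i) v w ->
  run_by_key S r (color_key outX) v = run_by_key S r (color_key outY) w.
Proof.
move=> idX idY [clX sepX] _ out_eq.
have keyE (u : X) (u' : Y) : sim rho.+1 u u' -> color_key outX u = color_key outY u'.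
  move=> uu'; rewrite /color_key (out_eq u u'); last by apply: sim_leq uu'.
  by case: (sim0 uu') => _ ->.
elim: i v w => [//|i IHi] v w; rewrite ltnS leq_eqVlt => /orP[/eqP vi vw|vi vw]; last first.
  by apply: IHi => //; apply: sim_leq vw; rewrite /color_radius; lia.
have radS : color_radius i.+1 = d * r + (r + color_radius i).
  by rewrite /color_radius mulSn; lia.
(* Similarity is always derived from [v], which is within [d * r] of its whole cluster, so the inner
   induction does not use up radius. *)
have in_cluster N : forall u u', (outX u).1 = (outX v).1 -> color_key outX u < N ->
    sim (r + color_radius i) u u' ->
    run_by_key S r (color_key outX) u = run_by_key S r (color_key outY) u'.
  elim: N => [//|N IHN] u u' uv uN uu'.
  rewrite !run_by_keyE; try exact: color_key_inj.
  case: (sim0 uu') => -> _ _; congr (Some (s_step _ _)).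
  apply: sim_slocal_view.
    by apply: sim_leq uu'; rewrite /color_radius; lia.
  move=> x x' xx' ux.
  have [ux' sx] := sim_dist_id xx' ux uu'.
  have kx : color_key outX x = color_key outY x'.
    by apply: keyE; apply: sim_leq sx; rewrite /color_radius; lia.
  have ku : color_key outX u = color_key outY u'.
    by apply: keyE; apply: sim_leq uu'; rewrite /color_radius; lia.
  rewrite kx ku; case: ifP => // lt.
  have := @color_key_leq X outX x u idX; rewrite kx ku => /(_ lt) le_col.
  have ui : (outX u).2 = i by rewrite -vi; case: (clX _ _ uv).
  (* A smaller color falls to the outer induction; an equal color at distance at most [r] forces the
     same cluster. *)
  case: (ltnP (outX x).2 i) => [xi|ix]; first exact: IHi.
  have xi : (outX x).2 = (outX u).2 by apply/eqP; rewrite eqn_leq le_col ui ix.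
  case: (sepX _ _ ux) => [ux1|]; last by rewrite xi.
  have xv : (outX v).1 = (outX x).1 by rewrite -uv.
  apply: IHN => //; first by rewrite kx; apply: leq_trans lt _; rewrite -ltnS -ku.
  have [vx _] := clX _ _ xv.
  by rewrite radS in vw; case: (sim_dist_id xx' vx vw).
apply: (in_cluster (color_key outX v).+1) => //.
by apply: sim_leq vw; rewrite radS leq_addl.
Qed.

End Locality.

(** * Hardness *)

Lemma decomposition_hard (k : nat)
    (diam : forall G : sgraph, {set G} -> nat -> Prop) d c :
  (forall (G : sgraph) (C : {set G}) m, diam G C m -> weak_diam_le C m) ->
  polylog d -> polylog c -> PSLOCAL_hard k (decomposition_problem diam d c).
Proof.
move=> diam_weak pd pc Q [r [pr [S S_ok]]] [t [pt [A A_ok]]].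
pose M n := 2 ^ (k * (trunc_log 2 n).+1).
pose out (X : network (input Q)) (v : X) : nat * nat :=
  let Y := power_network X (r #|X|) in
  local_run A (@net_id _ Y) (@net_inp _ Y) (t #|X|) v.
pose rho n := r n * t n.
(* Colors are at most [c n], and [run_by_key_local] asks for a strict bound. *)
pose T n := color_radius (r n) (d n) (rho n) (c n).+1.
exists T; split.
  rewrite /T /color_radius /rho.
  apply: (@polylog_le _ (fun n => (c n + 1) * (d n * r n + r n) + (r n * t n + 1))).
    by move=> n; rewrite !addn1.
  by repeat first [apply: polylogD | apply: polylogM | apply: polylog_const | assumption].
pose fin (X : network (input Q)) (v : X) : option (output Q) :=
  omap fst (run_by_key S (r #|X|) (color_key (M #|X|) (out X)) v).
have out_sep (X : network (input Q)) : valid_ids k (@net_id _ X) ->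
    separated (r #|X|) (d #|X|) (out X) /\ forall v, (out X v).2 <= c #|X|.
  move=> ids.
  (* The power graph has the same nodes, hence the same admissible identifiers. *)
  have [P [col [[part dP colP adjP] [rep1 rep2]]]] :=
    A_ok (power_graph X (r #|X|)) _ ids (fun=> tt).
  case/and3P: (part) => /eqP cov triv _.
  have inP (v : X) : pblock P v \in P by rewrite pblock_mem // cov inE.
  have mem_pb (v : X) : v \in pblock P v by rewrite mem_pblock cov inE.
  split; last first.
    by move=> v; rewrite [(out X v).2]rep2; case/andP: (colP _ (inP v)).
  split=> u w.
    move/rep1 => uw; split; last by rewrite [LHS]rep2 [RHS]rep2 uw.
    apply: dist_le_power; apply: (diam_weak _ _ _ (dP _ (inP u))) => //.
    by rewrite uw.
  move=> uw; case: (eqVneq (pblock P u) (pblock P w)) => [/rep1|ne]; first by left.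
  right; rewrite [(out X u).2]rep2 [(out X w).2]rep2; apply: adjP => //.
  split=> //; exists u, w; split=> //=.
  by apply/andP; split=> //; apply: contraNneq ne => ->.
have out_local (X Y : network (input Q)) (v : X) (w : Y) :
    sim (rho #|X|) v w -> out X v = out Y w.
  move=> vw; case: (sim0 vw) => n_eq _ _; rewrite /out -n_eq.
  congr (l_out _); apply: (sim_rounds A).
  exact: sim_power.
have fin_local (X Y : network (input Q)) (v : X) (w : Y) :
    valid_ids k (@net_id _ X) -> valid_ids k (@net_id _ Y) ->
    sim (T #|X|) v w -> fin X v = fin Y w.
  move=> idX idY vw; case: (sim0 vw) => n_eq _ _.
  have [sepX cX] := out_sep X idX; have [sepY _] := out_sep Y idY.
  rewrite /fin; congr omap; rewrite -n_eq in sepY *.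
  apply: (@run_by_key_local _ _ S (r #|X|) (d #|X|) (M #|X|) (rho #|X|) X Y
    (out X) (out Y) (c #|X|).+1) => //.
  - by case: idX.
  - by case: idY => _; rewrite -n_eq.
  - by move=> u u'; apply: out_local.
  - by rewrite ltnS.
(* Any output will do as the default of the choice operator; running the step on an empty view
   provides one. *)
pose o0 := (s_step (s := S) 0 (SView 0 (fun=> None) (fun _ _ => false))).1.
pose history (X : network (input Q)) : X -> transcript (input Q) :=
  net_rounds (full_info (@id (transcript (input Q)))) (T #|X|).
(* No network is reconstructed from the transcript: the answer is chosen among the results on all
   instances with this transcript. The actual instance shows that one exists, and [fin_local] makes
   all of them agree. *)
pose answer (tr : transcript (input Q)) : output Q :=
  epsilon (inhabits o0) (fun o => exists (X : network (input Q)) (v : X),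
    [/\ valid_ids k (@net_id _ X), history X v = tr & fin X v = Some o]).
exists (full_info answer) => G ids ids_ok inp.
pose X := @Network _ G ids inp ids_ok.1.
have [o [oE o_ok]] := S_ok G ids ids_ok inp
  (by_key (X := X) (color_key (M #|X|) (out X))) (permEl (perm_sort _ _)).
suff -> : local_run (full_info answer) ids inp (T #|G|) = o by [].
apply: functional_extensionality => v.
have finv : fin X v = Some (o v) by rewrite -oE.
have : exists o', exists (Y : network (input Q)) (w : Y),
    [/\ valid_ids k (@net_id _ Y), history Y w = history X v & fin Y w = Some o'].
  by exists (o v), X, v.
move=> /(epsilon_spec (inhabits o0)); rewrite -/(answer _).
case=> Y [w [idY /esym hist finw]].
suff : Some (answer (history X v)) = Some (o v) by case.
rewrite -finw -finv; apply/esym/fin_local => //.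
(* The number of rounds depends on the size, so the sizes must agree before the two transcripts can
   be compared. *)
have : #|X| = #|Y|.
  by have := congr1 (@graph_size _) hist; rewrite !graph_size_rounds.
move=> n_eq; move: hist; rewrite /history -n_eq.
exact: transcript_sim.
Qed.

(** * Carving clusters *)

Lemma induced_subrel (V : finType) (e : rel V) (C : {set V}) : subrel (induced e C) e.
Proof. by move=> x y /and3P[]. Qed.

Lemma induced_sym (V : finType) (e : rel V) (C : {set V}) :
  symmetric e -> symmetric (induced e C).
Proof. by move=> es x y; rewrite /induced /= es andbCA. Qed.

(** Peeling off the last edge of a walk from the center leaves a node that is closer, hence still in
    the ball. *)
Lemma dist_le_in_ball (V : finType) (e : rel V) (u x : V) r s :
  symmetric e -> s <= r -> dist_le e s u x ->
  dist_le (induced e [set y | dist_le e r u y]) s u x.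
Proof.
move=> es; elim: s x => [|s IH] x sr; first by move/dist_le0 ->; apply: dist_le_refl.
rewrite dist_le_sym // => ux; move: (ux) => /dist_leS[->|[w xw]].
  exact: dist_le_refl.
rewrite dist_le_sym // => uw; rewrite -addn1; apply: dist_le_trans (IH _ (ltnW sr) uw) _.
apply: dist_le_edge; rewrite /induced /= !inE es xw andbT.
by rewrite (dist_le_leq (ltnW sr) uw) (dist_le_leq sr) // dist_le_sym.
Qed.

Section Carving.
Variables (m L : nat).
Hypothesis card_le : m.+1 <= 2 ^ L.
(** The vertices are identifiers, because these are all that a sequential algorithm sees. *)
Let T := 'I_m.+1.
Let B := m.+2.

(* The progress of a node is [j * B] while it is waiting at level [j], and
   [j * B + c.+1] once it belongs to the cluster of color [j] around [c]. *)
Definition level (q : nat) : nat := q %/ B.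
Definition settled (q : nat) : bool := ~~ (B %| q).

Implicit Types (e : rel T) (p q : T -> nat) (u v x y z : T) (A D : {set T}).

(** [A] is to become a cluster and [D] its boundary. The ball growing itself is not mentioned, so
    that the property can be transferred from the known part of a graph to the whole. *)
Definition carvable e p u A D : bool :=
  [&& (u \in A) && [disjoint A & D], #|D| <= #|A|,
      [forall x in A :|: D, (p x == p u) && dist_le e L.+1 u x],
      [forall x in A, forall y, e x y && (p y == p u) ==> (y \in A :|: D)]
    & [forall x in A, forall y in A, dist_le (induced e A) (2 * L) x y]].

Definition carve p u A D : T -> nat :=
  fun x => if x \in A then p u + u.+1 else if x \in D then p u + B else p x.

(** If all balls up to radius [L] more than doubled, the one of radius [L.+1] would have at least
    [2 ^ L.+1] elements, more than there are vertices. *)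
Lemma carvable_exists e p u : symmetric e -> exists A D, carvable e p u A D.
Proof.
move=> es; pose X := [set x | p x == p u].
pose f := induced e X; have fs : symmetric f by apply: induced_sym.
pose ball r := [set x | dist_le f r u x].
have [r rL dbl] : exists2 r, r <= L & #|ball r.+1| <= 2 * #|ball r|.
  suff [r /andP[? ?]] : exists r : 'I_L.+1, (r <= L) && (#|ball r.+1| <= 2 * #|ball r|).
    by exists r.
  apply/existsP; apply: contraLR card_le; rewrite negb_exists => /forallP no.
  have grow r : r <= L.+1 -> 2 ^ r <= #|ball r|.
    elim: r => [_|r IH rL].
      by rewrite card_gt0; apply/set0Pn; exists u; rewrite inE dist_le_refl.
    move: (no (Ordinal rL)) => /=; rewrite -ltnS rL /= -ltnNge => lt.
    apply: leq_trans (ltnW lt); rewrite expnS leq_mul2l; apply: IH.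
    exact: ltnW.
  have := leq_trans (grow _ (leqnn _)) (max_card _).
  rewrite card_ord -ltnNge expnS; apply: leq_trans.
  by rewrite mul2n -addnn -addn1 leq_add2l expn_gt0.
have ballX s x : x \in ball s -> p x == p u.
  rewrite inE; have gen w : p w == p u -> dist_le f s w x -> p x == p u; last exact: gen.
  elim: s w => [|s IH] w; first by move=> ? /dist_le0 <-.
  move=> wu /dist_leS[<-//|[z /and3P[_ zX _] /IH]]; apply.
  by rewrite inE in zX.
have subb s : s <= r.+1 -> {subset ball s <= ball r.+1}.
  by move=> sr x; rewrite !inE; apply: dist_le_leq.
have AD : ball r :|: (ball r.+1 :\: ball r) = ball r.+1.
  apply/setP => x; rewrite in_setU in_setD.
  by case: (boolP (x \in ball r)) => //= /(subb r (leqnSn r)) ->.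
have fe : subrel f e := @induced_subrel _ e X.
exists (ball r), (ball r.+1 :\: ball r); apply/and5P; split.
- rewrite inE dist_le_refl -setI_eq0; apply/eqP/setP => x; rewrite !inE.
  by case: (dist_le f r u x).
- rewrite cardsD (setIidPr _); first by rewrite leq_subLR addnn -mul2n.
  by apply/subsetP/subb.
- rewrite AD; apply/forall_inP => x xb; rewrite (ballX _ _ xb) /=.
  by move: xb; rewrite inE; apply: dist_le_mono.
- apply/forall_inP => x xb; apply/forallP => y; apply/implyP => /andP[xy yu].
  rewrite AD inE -[r.+1]addn1; move: (xb); rewrite inE => ux.
  apply: dist_le_trans ux _; apply: dist_le_edge.
  by rewrite /f /induced /= !inE xy yu (ballX _ _ xb).
(* Walks from the center stay in the ball; two of them join any two of its points. *)
- have near x : x \in ball r -> dist_le (induced e (ball r)) L u x.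
    rewrite inE => /(dist_le_in_ball fs (leqnn r)); apply: dist_le_mono => //.
    by move=> y z /and3P[yb zb /fe yz]; apply/and3P.
  apply/forall_inP => x xb; apply/forall_inP => y yb.
  rewrite mul2n -addnn; apply: (@dist_le_trans _ _ _ _ _ u); last exact: near.
  by rewrite dist_le_sym; [apply: near|apply: induced_sym].
Qed.

Record progress_inv e p : Prop := Inv {
  inv_sep : forall x y, settled (p x) -> e x y -> p y = p x \/
    (if settled (p y) then level (p y) != level (p x)
     else level (p x) < level (p y));
  inv_diam : forall x y, settled (p x) -> p y = p x ->
    dist_le (induced e [set z | p z == p x]) (2 * L) x y;
  inv_center : forall x (c : T), settled (p x) -> p x %% B = c.+1 -> p c = p x;
  inv_count : forall j, #|[set x | j < level (p x)]| <=
    #|[set x | settled (p x) && (level (p x) == j)]| }.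

Lemma inv_initial e : progress_inv e (fun=> 0).
Proof.
by split=> //= j; rewrite (_ : [set x : T | _] = set0) ?cards0 //.
Qed.

Lemma inv_level e p x : progress_inv e p -> level (p x) <= L.
Proof.
move=> [_ _ _ cnt].
(* By [inv_count], at least half of the vertices that reach level [j] settle there. *)
have half j : 2 ^ j * #|[set x | j <= level (p x)]| <= m.+1.
  elim: j => [|j IH]; first by rewrite mul1n -[leqRHS]card_ord max_card.
  apply: leq_trans IH; rewrite expnSr -mulnA leq_mul2l mul2n -addnn; apply/orP; right.
  apply: leq_trans (leq_add (leqnn _) (cnt j)) _.
  rewrite -cardsUI (_ : _ :&: _ = set0) ?cards0 ?addn0.
    apply/subset_leq_card/subsetP => y; rewrite !inE.
    by case/orP=> [/ltnW//|/andP[_ /eqP->]].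
  by apply/setP => y; rewrite !inE; case: ltngtP; rewrite ?andbF.
rewrite leqNgt; apply/negP => Lx.
have := half L.+1; apply/negP; rewrite -ltnNge.
apply: (@leq_trans (2 ^ L.+1)).
  by rewrite expnS mul2n -addnn -add1n; apply: leq_add => //; rewrite expn_gt0.
by rewrite leq_pmulr // card_gt0; apply/set0Pn; exists x; rewrite inE.
Qed.

Lemma settled_center (q : nat) u : ~~ settled q ->
  [/\ settled (q + u.+1), level (q + u.+1) = level q & (q + u.+1) %% B = u.+1].
Proof.
have uB : u.+1 < B by rewrite ltnS; apply: ltn_ord.
rewrite /settled /level negbK => qB.
have e : (q + u.+1) %% B = u.+1 by rewrite -modnDml (eqP qB) add0n modn_small.
by split; rewrite ?divnDl // ?(divn_small uB) ?addn0 // /dvdn e.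
Qed.

Lemma waiting_next (q : nat) : ~~ settled q ->
  ~~ settled (q + B) /\ level (q + B) = (level q).+1.
Proof.
rewrite /settled /level !negbK => qB.
by rewrite dvdn_add // divnDl // divnn addn1.
Qed.

Lemma waiting_inj (q q' : nat) :
  ~~ settled q -> ~~ settled q' -> level q = level q' -> q = q'.
Proof.
rewrite /settled /level !negbK => /divnK qE /divnK q'E.
by rewrite -{2}qE -{2}q'E => ->.
Qed.

Definition grows p q : Prop := forall x, p x <= q x /\ (settled (p x) -> q x = p x).

Lemma grows_refl p : grows p p. Proof. by []. Qed.

Lemma grows_trans p1 p2 p3 : grows p1 p2 -> grows p2 p3 -> grows p1 p3.
Proof.
move=> g h x; case: (g x) (h x) => le1 eq1 [le2 eq2]; split=> [|s].
  exact: leq_trans le2.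
by rewrite eq2 eq1.
Qed.

Section Carve.
Variables (e : rel T) (p : T -> nat) (u : T) (A D : {set T}).
Hypotheses (pu : ~~ settled (p u)) (ok : carvable e p u A D).

Lemma carvable_center : u \in A. Proof. by case/and5P: ok => /andP[]. Qed.

Lemma carvable_eq x : x \in A :|: D -> p x = p u.
Proof. by case/and5P: ok => _ _ /forall_inP h _ _ /h /andP[/eqP]. Qed.

Lemma carvable_near x : x \in A :|: D -> dist_le e L.+1 u x.
Proof. by case/and5P: ok => _ _ /forall_inP h _ _ /h /andP[]. Qed.

Variant carve_spec x : bool -> bool -> nat -> Type :=
| CarveIn of x \in A & p x = p u : carve_spec x true false (p u + u.+1)
| CarveNext of x \in D & x \notin A & p x = p u : carve_spec x false true (p u + B)
| CarveOut of x \notin A & x \notin D : carve_spec x false false (p x).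

Lemma carveP x : carve_spec x (x \in A) (x \in D) (carve p u A D x).
Proof.
have := @carvable_eq x; rewrite /carve in_setU.
case/and5P: ok => /andP[_ dis] _ _ _ _.
case: (boolP (x \in A)) => [xA /(_ isT) h|xA].
  by rewrite (disjointFr dis xA); constructor.
by case: (boolP (x \in D)) => [xD /(_ isT) h|xD _]; constructor.
Qed.

Lemma carve_grows : grows p (carve p u A D).
Proof.
move=> x; case: carveP => [_ ->|_ _ ->|//]; split; rewrite ?leq_addr //.
  by rewrite (negbTE pu).
by rewrite (negbTE pu).
Qed.

(** The last hypothesis keeps lower waiting levels away from the new cluster. Its radius is [L.+1]
    for the cluster and one more for the neighbors. *)
Lemma carve_inv : symmetric e -> progress_inv e p ->
  (forall y, dist_le e L.+2 u y -> settled (p y) || (level (p u) <= level (p y))) ->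
  progress_inv e (carve p u A D).
Proof.
move=> es [sep diam cen cnt] low.
have [s1 l1 m1] := settled_center u pu.
have [s2 l2] := waiting_next pu.
(* Such a [z] would lie in a cluster around [u], so that [u] would be settled already. *)
have fresh z : p z != p u + u.+1.
  apply/eqP => pz; have := cen z u; rewrite pz s1 => /(_ isT m1) pu'.
  by move: pu; rewrite pu' s1.
split.
- move=> x y; case: (carveP x) => [xA px _ xy|_ _ _|xA xD sx xy]; last 2 first.
  + by rewrite (negbTE s2).
  + have := sep _ _ sx xy; case: (carveP y) => [yA py|yD yA py|//].
      rewrite py (negbTE pu) s1 l1 => -[h|h]; first by rewrite -h (negbTE pu) in sx.
      by right; rewrite neq_ltn h orbT.
    rewrite py (negbTE pu) (negbTE s2) l2 => -[h|h]; first by rewrite -h (negbTE pu) in sx.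
    by right; rewrite ltnS ltnW.
  + case: (carveP y) => [_ _|_ _ _|yA yD]; first by left.
      by right; rewrite (negbTE s2) l1 l2.
    (* A settled [y] is handled by the old invariant read from [y]. A waiting [y] on the level of
       [u] would have been put into [A] or [D]. *)
    right; rewrite l1; case: (boolP (settled (p y))) => sy.
      have := sep y x sy; rewrite es px (negbTE pu) => /(_ xy)[h|h].
        by rewrite -h (negbTE pu) in sy.
      by rewrite neq_ltn h.
    have := low y; rewrite (negbTE sy) /= leq_eqVlt.
    have -> : dist_le e L.+2 u y.
      rewrite -[L.+2]addn1; apply: dist_le_trans (dist_le_edge xy).
      by apply: carvable_near; rewrite inE xA.
    case/(_ isT)/orP=> // /eqP/(waiting_inj pu sy) py.
    case/and5P: ok => _ _ _ /forall_inP/(_ x xA)/forallP/(_ y) + _.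
    by rewrite xy py eqxx inE (negbTE yA) (negbTE yD).
- move=> x y; case: (carveP x) => [xA px _|_ _ _|xA xD sx].
  + case: (carveP y) => [yA _ _|_ _ _ h|_ _ /eqP]; last by rewrite (negbTE (fresh y)).
      have -> : [set z | carve p u A D z == p u + u.+1] = A.
        apply/setP => z; rewrite inE; case: carveP => [_ _|_ _ _|_ _].
        * exact: eqxx.
        * by apply/eqP => h; move: s2; rewrite h s1.
        * exact: negbTE (fresh z).
      case/and5P: ok => _ _ _ _ /forall_inP/(_ x xA)/forall_inP; exact.
    by move: s2; rewrite h s1.
  + by rewrite (negbTE s2).
  + case: (carveP y) => [_ _ /esym/eqP|_ _ _ h|_ _ yx]; first by rewrite (negbTE (fresh x)).
      by move: s2; rewrite h sx.
    apply: dist_le_mono (diam _ _ sx yx) => // a b.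
    have sub z : p z == p x -> carve p u A D z == p x.
      by move=> /eqP zx; case: (carve_grows z) => _ ->; rewrite zx.
    by case/and3P; rewrite !inE => /sub ax /sub bx ab; rewrite /induced /= !inE ax bx.
- move=> x c; case: (carveP x) => [xA px _|_ _ _|xA xD sx].
  + rewrite m1 => -[/val_inj <-].
    by case: (carveP u) carvable_center.
  + by rewrite (negbTE s2).
  + move=> xc; have pc := cen _ _ sx xc.
    by case: (carve_grows c) => _ ->; rewrite pc.
- move=> j; set S := [set x | _]; set F := [set x | _].
  pose S0 := [set x | j < level (p x)].
  pose F0 := [set x | settled (p x) && (level (p x) == j)].
  have F0F : F0 \subset F.
    apply/subsetP => x; rewrite !inE => /andP[sx xj].
    by case: (carve_grows x) => _ ->; rewrite ?sx.
  case: (eqVneq j (level (p u))) => [ju|ju].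
    (* Only this level changes its count: at most [D] moves beyond it, and [A], which is at least as
       large, settles on it. *)
    have SD : S \subset S0 :|: D.
      apply/subsetP => x; rewrite !inE; case: carveP => [_ ->|_ _ _|_ _ ->] //.
        by rewrite l1 => ->.
      by rewrite orbT.
    have FA : F0 :|: A \subset F.
      rewrite subUset F0F; apply/subsetP => x xA; rewrite inE.
      by case: carveP xA => // _ _ _; rewrite s1 l1 ju eqxx.
    have F0A : F0 :&: A = set0.
      apply/setP => x; rewrite !inE; case: (boolP (x \in A)) => xA; rewrite ?andbF //.
      by rewrite (carvable_eq (x := x)) ?inE ?xA // (negbTE pu).
    apply: leq_trans (subset_leq_card SD) _.
    apply: leq_trans (leq_card_setU _ _) _.
    apply: leq_trans (subset_leq_card FA).
    rewrite cardsU F0A cards0 subn0; apply: leq_add; first exact: cnt.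
    by case/and5P: ok.
  apply: leq_trans (subset_leq_card F0F); apply: leq_trans (cnt j).
  apply/subset_leq_card/subsetP => x; rewrite !inE.
  case: carveP => [_ ->|_ _ ->|//]; first by rewrite l1.
  by rewrite l2 ltnS leq_eqVlt (negbTE ju).
Qed.

End Carve.

(** * Carving all levels from the view of one node *)

Definition reach : nat := L.+1 * L.+2.

Definition carve_at e j p u : T -> nat :=
  if ~~ settled (p u) && (level (p u) == j) then
    if [pick AD : {set T} * {set T} | carvable e p u AD.1 AD.2] is Some AD
    then carve p u AD.1 AD.2 else p
  else p.

Definition phase e v p j : T -> nat :=
  foldl (carve_at e j) p
    [seq u <- enum T | dist_le e ((L - j) * L.+2) v u].

(* Level [j] is carved in a ball whose radius shrinks with [j], so that a node
   carved at level [j] only meets nodes whose lower levels are finished. *)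
Definition resolve e v p : T -> nat := foldl (phase e v) p (iota 0 L.+1).

Section Resolve.
Variables (e : rel T) (v : T) (r : nat).
Hypotheses (es : symmetric e) (reach_r : reach <= r).

Let ev := induced e [set x | dist_le e r v x].

Lemma ball_subrel : subrel ev e.
Proof. exact: induced_subrel. Qed.

(** Far away [q] may be outdated but never too large, so that merging by maxima restores the true
    progress. *)
Definition agree q p : Prop :=
  (forall x, dist_le e reach v x -> q x = p x) /\ (forall x, q x <= p x).

Definition passed j (n : nat) : bool := settled n || (j <= level n).

Lemma passed_grows p p' j x : grows p p' -> passed j (p x) -> passed j (p' x).
Proof.
move=> /(_ x)[le eq]; rewrite /passed; case: (boolP (settled (p x))) => [s _|_ /= jp].
  by rewrite eq // s.
by rewrite (leq_trans jp) ?orbT // leq_div2r.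
Qed.

(* [q] is what is known of the global progress [p], which is [p0] initially. *)
Definition tracks p0 q p : Prop :=
  [/\ progress_inv e p, agree q p, grows p0 p
    & forall x, ~~ dist_le e reach v x -> p x = p0 x].

(** The sets found in the known graph are carved from the global progress too: all that the choice
    inspects lies within [reach], where both views coincide. *)
Lemma carve_at_tracks p0 q p j u :
  j <= L -> tracks p0 q p -> dist_le e ((L - j) * L.+2) v u ->
  (forall x, dist_le e ((L - j).+1 * L.+2) v x -> passed j (p x)) ->
  exists p', [/\ tracks p0 (carve_at ev j q u) p', grows p p' & passed j.+1 (p' u)].
Proof.
move=> jL [ip [eq_qp le_qp] g0 far] vu low.
have near x s : s <= L.+2 -> dist_le e s u x -> dist_le e reach v x.
  move=> sL ux; apply: dist_le_leq (dist_le_trans vu ux).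
  by rewrite /reach mulSn addnC leq_add // leq_mul2r leq_subr orbT.
have qu : q u = p u by apply: eq_qp; apply: (near u 0) => //; apply: dist_le_refl.
have := low u; rewrite (dist_le_leq _ vu) ?leq_mul2r ?leqnSn ?orbT // => /(_ isT) pj.
rewrite /carve_at qu.
have skip : passed j.+1 (p u) ->
    exists p', [/\ tracks p0 q p', grows p p' & passed j.+1 (p' u)].
  by move=> pu; exists p; split=> //; apply: grows_refl.
case: ifP => [/andP[pu /eqP lj]|no]; last first.
  apply: skip; move: pj no; rewrite /passed; case: settled => //= jl.
  by rewrite ltn_neqAle jl andbT eq_sym => ->.
case: pickP => [[A D] /= ok|none]; last first.
  have [A [D ok]] := carvable_exists q u (@induced_sym _ e [set x | dist_le e r v x] es).
  by have := none (A, D); rewrite /= ok.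
have qu' : ~~ settled (q u) by rewrite qu.
have nearAD x : x \in A :|: D -> dist_le e L.+1 u x.
  by move/(carvable_near ok); apply: dist_le_mono => //; apply: ball_subrel.
have okp : carvable e p u A D.
  case/and5P: ok => h1 h2 /forall_inP h3 /forall_inP h4 /forall_inP h5.
  apply/and5P; split=> //.
  - apply/forall_inP => x xAD; rewrite nearAD // andbT.
    have /andP[] := h3 _ xAD; rewrite qu eq_qp //.
    exact: (near x L.+1) (leqnSn _) (nearAD _ xAD).
  - apply/forall_inP => x xA; apply/forallP => y; apply/implyP => /andP[xy /eqP yu].
    have ux : dist_le e L.+1 u x by apply: nearAD; rewrite inE xA.
    have vx : dist_le e reach v x := near x L.+1 (leqnSn _) ux.
    have vy : dist_le e reach v y.
      apply: (near y L.+2) => //; rewrite -[L.+2]addn1.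
      exact: dist_le_trans ux (dist_le_edge xy).
    move/forallP/(_ y)/implyP: (h4 _ xA); apply.
    rewrite qu eq_qp // yu eqxx andbT /ev /induced /= !inE xy andbT.
    by rewrite !(dist_le_leq reach_r).
  - apply/forall_inP => x xA; apply/forall_inP => y yA.
    move/forall_inP: (h5 _ xA) => /(_ _ yA); apply: dist_le_mono => // a b.
    by case/and3P=> aA bA /ball_subrel ab; apply/and3P.
have gp : grows p (carve p u A D) by apply: carve_grows okp.
exists (carve p u A D); split=> //.
  split.
  - apply: carve_inv => // y uy; rewrite lj; apply: low.
    by rewrite mulSn addnC; apply: dist_le_trans uy.
  - split=> x; rewrite /carve qu; first by move/eq_qp->.
    by case: ifP => // _; case: ifP.
  - exact: grows_trans gp.
  - move=> x vx; rewrite -far //.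
    have : x \notin A :|: D.
      by apply: contra vx => /nearAD; apply: (near x L.+1); apply: leqnSn.
    by rewrite inE negb_or /carve => /andP[/negbTE-> /negbTE->].
have [s _ _] := settled_center u pu.
by rewrite /passed /carve (carvable_center okp) s.
Qed.

Lemma phase_tracks p0 q p j :
  j <= L -> tracks p0 q p ->
  (forall x, dist_le e ((L - j).+1 * L.+2) v x -> passed j (p x)) ->
  exists p', [/\ tracks p0 (phase ev v q j) p', grows p p'
    & forall x, dist_le e ((L - j) * L.+2) v x -> passed j.+1 (p' x)].
Proof.
move=> jL; rewrite /phase.
(* The list is computed with distances in [ev]; inside the ball these agree with distances in
   [e]. *)
set s := [seq u <- _ | _].
have s_in x : dist_le e ((L - j) * L.+2) v x -> x \in s.
  move=> vx; rewrite mem_filter mem_enum andbT.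
  apply: dist_le_in_ball => //; apply: leq_trans reach_r.
  by rewrite /reach leq_mul // (leq_trans (leq_subr _ _)).
have : {in s, forall x, dist_le e ((L - j) * L.+2) v x}.
  move=> x; rewrite mem_filter => /andP[+ _].
  by apply: dist_le_mono => //; apply: ball_subrel.
move=> s_near tr low.
suff [p' [tr' g' pass]] : exists p', [/\ tracks p0 (foldl (carve_at ev j) q s) p',
    grows p p' & {in s, forall x, passed j.+1 (p' x)}].
  by exists p'; split=> // x /s_in; apply: pass.
elim: s s_near {s_in} q p tr low => [|u s IH] s_near q p tr low.
  by exists p; split=> //; apply: grows_refl.
have vu := s_near u (mem_head u s).
have [p1 [tr1 g1 pass1]] := carve_at_tracks jL tr vu low.
have [|||p2 [tr2 g2 pass2]] := IH _ (carve_at ev j q u) p1 => //.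
- by move=> x xs; apply: s_near; rewrite inE xs orbT.
- by move=> x /low; apply: passed_grows.
exists p2; split=> //; first exact: grows_trans g2.
move=> x; rewrite inE => /orP[/eqP->|]; last exact: pass2.
exact: passed_grows pass1.
Qed.

(** After all phases [v] has passed level [L], and by [inv_level] no vertex waits beyond it, so [v]
    is settled. *)
Lemma resolve_tracks p0 q : progress_inv e p0 -> agree q p0 ->
  exists2 p, tracks p0 (resolve ev v q) p & settled (p v).
Proof.
move=> ip ag; rewrite /resolve.
suff [p [tr _ low]] : exists p, [/\ tracks p0 (foldl (phase ev v) q (iota 0 L.+1)) p,
    grows p0 p & forall x, dist_le e ((L - L) * L.+2) v x -> passed L.+1 (p x)].
  exists p => //; have := low v (dist_le_refl _ _ _); rewrite /passed ltnNge.
  by case: tr => ip' _ _ _; rewrite (inv_level v ip') orbF.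
(* After [j] phases all levels below [j] are finished within a radius that is [L.+2] smaller per
   phase. *)
have main j : j <= L.+1 -> exists p, [/\ tracks p0 (foldl (phase ev v) q (iota 0 j)) p,
    grows p0 p & forall x, dist_le e ((L.+1 - j) * L.+2) v x -> passed j (p x)].
  elim: j => [_|j IH jL].
    exists p0; split; [by split | by [] |].
    by move=> x _; rewrite /passed leq0n orbT.
  have [p [tr g low]] := IH (ltnW jL).
  rewrite subSn // in low; have [p' [tr' g' low']] := phase_tracks jL tr low.
  exists p'; split=> //; last exact: grows_trans g'.
  by rewrite -addn1 iotaD foldl_cat.
have [p [tr g low]] := main L.+1 (leqnn _).
by exists p; split=> // x; rewrite subnn -(subnn L.+1); apply: low.
Qed.

End Resolve.
End Carving.

(** * The sequential algorithm *)

Definition recorded (O : Type) (o : option (O * (nat -> nat))) (i : nat) : nat :=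
  if o is Some (_, st) then st i else 0.

Definition id_bound (k n : nat) : nat := 2 ^ (k * (trunc_log 2 n).+1).
Definition depth (k n : nat) : nat := (k * (trunc_log 2 n).+1).+1.

Lemma id_bound_depth k n : (id_bound k n).+1 <= 2 ^ depth k n.
Proof. by rewrite /depth expnS mul2n -addnn -add1n leq_add2r expn_gt0. Qed.

(** The progress value names the cluster; colors are shifted because they start at 1. *)
Definition answer (m q : nat) : nat * nat := (q, (level m q).+1).

(* The state of a node is all it knows of the progress of identifiers; progress
   only increases, so states are merged by taking maxima. *)
Definition carving_step (k n : nat) (s : sview unit ((nat * nat) * (nat -> nat))) :
    (nat * nat) * (nat -> nat) :=
  let m := id_bound k n in
  let e : rel 'I_m.+1 := fun x y => sv_edge s x y in
  let known (x : 'I_m.+1) :=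
    \max_(w < m.+1) (if sv_node s w is Some (_, o) then recorded o x else 0) in
  let q := resolve (depth k n) e (inord (sv_self s)) known in
  (answer m (q (inord (sv_self s))), fun i => q (inord i)).

Definition carving_alg (k : nat) : slocal_alg unit (nat * nat) :=
  SlocalAlg (carving_step k).

(** * Correctness for every processing order *)

Section Run.
Variables (k : nat) (G : sgraph) (id : G -> nat).
Hypothesis id_ok : valid_ids k id.

Let n := #|G|.
Let m := id_bound k n.
Let L := depth k n.
Let T := 'I_m.+1.
Let a := reach L.
Let S := carving_alg k.

Definition code (u : G) : T := inord (id u).

Lemma codeK u : code u = id u :> nat.
Proof. by rewrite inordK //; case: id_ok => _ /(_ u) h; apply: leq_trans h _. Qed.

Lemma code_inj : injective code.
Proof. by move=> u w /(congr1 val) /=; rewrite !codeK; apply: id_ok.1. Qed.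

Definition code_edge : rel T :=
  fun x y => [exists u, exists w, [&& code u == x, code w == y & edge u w]].

Lemma code_edgeP x y :
  reflect (exists u w, [/\ code u = x, code w = y & edge u w]) (code_edge x y).
Proof.
apply: (iffP existsP) => [[u /existsP[w /and3P[/eqP ux /eqP wy uw]]]|].
  by exists u, w.
by move=> [u [w [<- <- uw]]]; exists u; apply/existsP; exists w; rewrite !eqxx.
Qed.

Lemma code_edgeE u w : code_edge (code u) (code w) = edge u w.
Proof.
apply/code_edgeP/idP => [[u' [w' [/code_inj-> /code_inj->]]]//|uw].
by exists u, w.
Qed.

Lemma code_edge_sym : symmetric code_edge.
Proof.
by move=> x y; apply/code_edgeP/code_edgeP => -[u [w [? ? ?]]]; exists w, u; rewrite edge_sym.
Qed.

(** A walk that starts at the code of a node visits only codes. The relations are general so that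
    induced subgraphs are covered. *)
Lemma code_dist (e : rel T) (f : rel G) d u x :
  (forall u w, e (code u) (code w) -> f u w) -> subrel e code_edge ->
  dist_le e d (code u) x -> exists2 w, code w = x & dist_le f d u w.
Proof.
move=> ef sub; elim: d u => [|d IH] u.
  by move/dist_le0 <-; exists u => //; apply: dist_le_refl.
case/dist_leS=> [<-|[y uy yx]]; first by exists u => //; apply: dist_le_refl.
case/code_edgeP: (sub _ _ uy) => _ [z [_ zy _]]; rewrite -zy in uy yx.
have [w wx zw] := IH _ yx; exists w => //; rewrite -add1n.
by apply: dist_le_trans zw; apply: dist_le_edge; apply: ef.
Qed.

Lemma code_distE d u w : dist_le code_edge d (code u) (code w) = dist_le (@edge G) d u w.
Proof.
apply/idP/idP.
  case/(code_dist (f := @edge G)) => [u' w'|//|w']; first by rewrite code_edgeE.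
  by move/code_inj->.
elim: d u => [|d IH] u; first by move/dist_le0->; apply: dist_le_refl.
case/dist_leS=> [->|[z uz /IH zw]]; first exact: dist_le_refl.
rewrite -[d.+1]add1n; apply: dist_le_trans zw; apply: dist_le_edge.
by rewrite code_edgeE.
Qed.

(** The true progress, merged from all states; it serves the analysis only. *)
Definition progress (mem : smemory S G) (x : T) : nat :=
  \max_(w : G) recorded (mem w) x.

Record mem_inv (mem : smemory S G) : Prop := MemInv {
  mem_progress : progress_inv L code_edge (progress mem);
  mem_writer : forall x, 0 < progress mem x -> exists w,
    [/\ mem w, recorded (mem w) x = progress mem x
      & dist_le code_edge a (code w) x];
  mem_out : forall w o st, mem w = Some (o, st) ->
    settled m (progress mem (code w)) /\ o = answer m (progress mem (code w)) }.

Definition empty_mem : smemory S G := fun=> None.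

Lemma mem_inv_empty : mem_inv empty_mem.
Proof.
have p0 : progress empty_mem = fun=> 0.
  by apply: functional_extensionality => x; rewrite /progress big1.
by split; rewrite ?p0 //; apply: inv_initial.
Qed.

Lemma ball_nodeE r v i u :
  ball_node id r v i = Some u <-> dist_le (@edge G) r v u /\ id u = i.
Proof.
rewrite /ball_node; case: pickP => [w /andP[vw /eqP wi]|no]; split=> //.
- by case=> <-.
- by case=> _ ui; congr Some; apply: id_ok.1; rewrite ui.
- by case=> vu ui; move: (no u); rewrite vu ui eqxx.
Qed.

Variable inp : G -> unit.
(** A node needs the progress within distance [a], and by [mem_writer] each such value is stored at
    most [a] further away. *)
Let r := 2 * a.

Lemma view_edge (mem : smemory S G) v (x y : T) :
  sv_edge (slocal_view id inp r mem v) x y =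
  induced code_edge [set z | dist_le code_edge r (code v) z] x y.
Proof.
rewrite /slocal_view /induced /= !inE.
have in_ball (z : T) w : ball_node id r v z = Some w ->
    code w = z /\ dist_le code_edge r (code v) z.
  move/ball_nodeE => [vw wz]; have e : code w = z by apply: val_inj; rewrite /= codeK.
  by rewrite -e code_distE.
have out_ball (z : T) w : ball_node id r v z = None -> code w = z ->
    dist_le code_edge r (code v) z = false.
  move=> none wz; apply/negbTE/negP; rewrite -wz code_distE => vw.
  by have := (ball_nodeE r v z w).2; rewrite none -wz codeK => /(_ (conj vw erefl)).
case xE: (ball_node id r v x) => [u|].
  case yE: (ball_node id r v y) => [w|].
    have [<- ->] := in_ball _ _ xE; have [<- ->] := in_ball _ _ yE.
    by rewrite code_edgeE.
  apply/esym/and3P => -[_ dy /code_edgeP[_ [w [_ wy _]]]].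
  by rewrite (out_ball _ _ yE wy) in dy.
apply/esym/and3P => -[dx _ /code_edgeP[u [_ [ux _ _]]]].
by rewrite (out_ball _ _ xE ux) in dx.
Qed.

Lemma process_inv (mem : smemory S G) v :
  mem v = None -> mem_inv mem -> mem_inv (slocal_process id inp r mem v).
Proof.
move=> vN [ip writer out].
set mem' := slocal_process _ _ _ _ _.
pose s := slocal_view id inp r mem v.
pose e : rel T := fun x y => sv_edge s x y.
pose known (x : T) :=
  \max_(w < m.+1) (if sv_node s w is Some (_, o) then recorded o x else 0).
pose q := resolve L e (code v) known.
have mem'E u : mem' u = if u == v then Some (answer m (q (code v)), fun i => q (inord i))
    else mem u by [].
have eE : e = induced code_edge [set z | dist_le code_edge r (code v) z].
  apply: functional_extensionality => x; apply: functional_extensionality => y.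
  exact: view_edge.
have nodeE w u o : sv_node s w = Some (u, o) -> exists2 z, id z = w & o = mem z.
  rewrite /s /=; case zE: ball_node => [z|] //= [_ <-].
  by case/ball_nodeE: zE => _ zw; exists z.
have known_le x : known x <= progress mem x.
  apply/bigmax_leqP => w _; case E: (sv_node s w) => [[u o]|] //.
  by have [z _ ->] := nodeE _ _ _ E; apply: (bigmax_sup z).
have known_near x : dist_le code_edge a (code v) x -> known x = progress mem x.
  move=> vx; apply/eqP; rewrite eqn_leq known_le /=.
  case: (posnP (progress mem x)) => [->//|/writer[w [_ <- wx]]].
  apply: (bigmax_sup (code w)) => //.
  suff -> : sv_node s (code w) = Some (inp w, mem w) by [].
  rewrite /s /=; suff -> : ball_node id r v (code w) = Some w by [].
  apply/ball_nodeE; split; last by rewrite codeK.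
  rewrite -code_distE /r mul2n -addnn; apply: dist_le_trans vx _.
  by rewrite dist_le_sym //; apply: code_edge_sym.
have ar : reach L <= r by rewrite /r mul2n -addnn leq_addr.
have [p [ip' [q_near q_le] gp far] pv] := resolve_tracks
  (id_bound_depth k n) (v := code v) code_edge_sym ar ip (conj known_near known_le).
rewrite -eE -/q in q_near q_le.
have progE : progress mem' = p.
  apply: functional_extensionality => x.
  (* Near [v] the maximum is [q], as progress only grows; far from [v] it is the old value, as [q]
     stays below it. *)
  have -> : progress mem' x = maxn (q x) (progress mem x).
    rewrite /progress (bigD1 v) //= mem'E eqxx /= inord_val.
    rewrite [in RHS](bigD1 v) //= vN /= max0n.
    by congr maxn; apply: eq_bigr => w /negbTE wv; rewrite mem'E wv.
  case: (boolP (dist_le code_edge (reach L) (code v) x)) => vx.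
    by rewrite q_near //; apply/maxn_idPl; case: (gp x).
  by rewrite -(far _ vx); apply/maxn_idPr/q_le.
split; rewrite progE //.
- move=> x px.
  case: (eqVneq (p x) (progress mem x)) => [pE|ne].
    rewrite pE in px *; have [w [mw wE wx]] := writer _ px.
    exists w; rewrite mem'E; suff -> : (w == v) = false by [].
    by apply: contraTF mw => /eqP ->; rewrite vN.
  (* A value that has changed lies within [reach] of [v], which is therefore its writer. *)
  exists v; rewrite mem'E eqxx /= inord_val.
  have vx : dist_le code_edge (reach L) (code v) x.
    by apply: contraNT ne => /far ->.
  by rewrite q_near.
- move=> w o st; rewrite mem'E; case: eqP => [-> [<- _]|_ /out[sw ->]].
    by rewrite q_near //; apply: dist_le_refl.
  by case: (gp (code w)) => _ ->.
Qed.

Lemma run_inv (s : seq G) : uniq s ->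
  mem_inv (slocal_run S id inp r s) /\
  (forall u, (slocal_run S id inp r s u : bool) = (u \in s)).
Proof.
elim/last_ind: s => [_|s v IH]; first by split=> //; apply: mem_inv_empty.
rewrite rcons_uniq /slocal_run foldl_rcons => /andP[vs /IH[mi ms]].
split.
  apply: process_inv => //; move: (ms v); rewrite (negbTE vs) /slocal_run.
  by case: foldl.
move=> u; rewrite mem_rcons inE /slocal_process; case: eqP => //= _.
exact: ms.
Qed.

End Run.

(** * Membership and completeness *)

Definition carving_diam (k n : nat) : nat := 2 * depth k n.
Definition carving_colors (k n : nat) : nat := (depth k n).+1.

(** The clusters are the fibers of the progress on nodes, and the color of a cluster is its level
    plus one. *)
Lemma carving_valid k (G : sgraph) (id : G -> nat) (p : 'I_(id_bound k #|G|).+1 -> nat)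
    (diam : forall G : sgraph, {set G} -> nat -> Prop) d c :
  valid_ids k id ->
  (forall (G : sgraph) (C : {set G}) i j, i <= j -> strong_diam_le C i -> diam G C j) ->
  carving_diam k #|G| <= d #|G| -> carving_colors k #|G| <= c #|G| ->
  progress_inv (depth k #|G|) (code_edge (k := k) id) p ->
  (forall u, settled (id_bound k #|G|) (p (code k id u))) ->
  @valid (decomposition_problem diam d c) G (fun=> tt)
    (fun u => answer (id_bound k #|G|) (p (code k id u))).
Proof.
move=> id_ok strong_diam le_d le_c ip st.
pose f u := p (code k id u); pose P := preim_partition f [set: G].
have part : partition P [set: G] by apply: preim_partitionP.
case/and3P: (part) => /eqP cov triv _.
have inP v : pblock P v \in P by rewrite pblock_mem // cov inE.
have mem_pb v : v \in pblock P v by rewrite mem_pblock cov inE.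
have blockE u v : (v \in pblock P u) = (f u == f v).
  rewrite /P /preim_partition pblock_equivalence_partition ?inE //.
  by split=> [|/eqP->]; rewrite ?eqxx.
(* The default 0 is met only on the empty set, which is no cluster. *)
pose col (C : {set G}) :=
  if [pick u in C] is Some u then (level (id_bound k #|G|) (f u)).+1 else 0.
have colE u : col (pblock P u) = (level (id_bound k #|G|) (f u)).+1.
  rewrite /col; case: pickP => [w|/(_ u)]; last by rewrite mem_pb.
  by rewrite blockE => /eqP ->.
have exP C : C \in P -> exists u, C = pblock P u.
  move=> CP; have : C != set0 by case/and3P: part => _ _; apply: contraNneq => <-.
  by case/set0Pn=> u uC; exists u; rewrite (def_pblock triv CP uC).
exists P, col; split; last first.
  split=> [u v|v]; last by rewrite colE.
  split=> /= [fE|PE].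
    by apply/esym/same_pblock => //; rewrite blockE; apply/eqP.
  by apply/eqP; rewrite -/(f u) -/(f v) -blockE PE.
split=> //.
- move=> _ /exP[x ->]; apply: strong_diam le_d _ => u v ux vx.
  have uE : f u = f x by move: ux; rewrite blockE => /eqP.
  have vE : f v = f u by move: vx; rewrite blockE uE => /eqP.
  have := inv_diam ip (st u) vE.
  case/(code_dist (f := induced (@edge G) (pblock P x))) => [y z|y z|w].
  + case/and3P; rewrite !inE code_edgeE // -!/(f _) uE => /eqP yx /eqP zx yz.
    by rewrite /induced /= !blockE yx zx eqxx.
  + by case/and3P.
  + by move/(code_inj id_ok)->.
- move=> _ /exP[x ->]; rewrite colE /=; apply: leq_trans le_c.
  by rewrite ltnS (inv_level (id_bound_depth k _) _ ip).
- move=> _ _ /exP[x ->] /exP[y ->] [ne [u [v [ux vy uv]]]].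
  move: ux vy; rewrite !blockE !colE => /eqP xu /eqP yv [lE].
  have := inv_sep ip (st u) (y := code k id v); rewrite code_edgeE // => /(_ uv).
  (* With equal levels [inv_sep] leaves only equal progress, that is, a single cluster. *)
  rewrite st -!/(f _) -xu -yv lE eqxx => -[] // fE.
  case/negP: ne; apply/eqP/esym/same_pblock => //.
  by rewrite blockE fE.
Qed.

Lemma polylog_depth k : polylog (depth k).
Proof.
apply: (@polylog_le _ (fun n => k * (trunc_log 2 n + 1) + 1)) => [n|].
  by rewrite /depth !addn1.
by repeat first [apply: polylogD | apply: polylogM | apply: polylog_const
                | apply: polylog_log].
Qed.

Lemma decomposition_PSLOCAL k (diam : forall G : sgraph, {set G} -> nat -> Prop) d c :
  (forall (G : sgraph) (C : {set G}) i j, i <= j -> strong_diam_le C i -> diam G C j) ->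
  (forall n, carving_diam k n <= d n) -> (forall n, carving_colors k n <= c n) ->
  PSLOCAL k (decomposition_problem diam d c).
Proof.
move=> strong_diam le_d le_c.
exists (fun n => 2 * reach (depth k n)); split.
  apply: (@polylog_le _ (fun n => 2 * ((depth k n + 1) * (depth k n + 2)))).
    by move=> n; rewrite addn1 addn2.
  by repeat first [apply: polylogD | apply: polylogM | apply: polylog_const
                  | apply: polylog_depth].
exists (carving_alg k) => G id id_ok inp order order_all.
have order_uniq : uniq order by rewrite (perm_uniq order_all) enum_uniq.
have [mi ms] := run_inv id_ok inp order_uniq.
move: mi ms; set mem := slocal_run _ _ _ _ _ => mi ms.
have memE v : exists2 st,
    mem v = Some (answer (id_bound k #|G|) (progress mem (code k id v)), st)
    & settled (id_bound k #|G|) (progress mem (code k id v)).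
  have := ms v; rewrite (perm_mem order_all) mem_enum.
  by case E: (mem v) => [[o st]|//] _; have [? oE] := mem_out mi E; exists st; rewrite -?oE.
exists (fun v => answer (id_bound k #|G|) (progress mem (code k id v))); split.
  by move=> v; rewrite -/mem; case: (memE v) => st ->.
by apply: carving_valid => // [|v]; [case: mi|case: (memE v)].
Qed.

(** Both diameters are treated at once: hardness uses that the bound implies the weak one,
    membership that the strong one implies it. Too small parameters admit no decomposition, hence
    the thresholds. *)
Lemma decomposition_complete k (diam : forall G : sgraph, {set G} -> nat -> Prop) :
  (forall (G : sgraph) (C : {set G}) m, diam G C m -> weak_diam_le C m) ->
  (forall (G : sgraph) (C : {set G}) i j, i <= j -> strong_diam_le C i -> diam G C j) ->
  (exists d0 c0 : nat -> nat, polylog d0 /\ polylog c0 /\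
     forall d c : nat -> nat, polylog d -> polylog c ->
       (forall n, d0 n <= d n) -> (forall n, c0 n <= c n) ->
       PSLOCAL_complete k (decomposition_problem diam d c))
  /\ (forall d c : nat -> nat, polylog d -> polylog c ->
       PSLOCAL_hard k (decomposition_problem diam d c)).
Proof.
move=> diam_weak strong_diam; split; last by move=> d c; apply: decomposition_hard.
exists (carving_diam k), (carving_colors k); split.
  by apply: polylogM; [apply: polylog_const|apply: polylog_depth].
split.
  apply: (@polylog_le _ (fun n => depth k n + 1)) => [n|]; first by rewrite addn1.
  by apply: polylogD; [apply: polylog_depth|apply: polylog_const].
move=> d c pd pc le_d le_c; split; first exact: decomposition_PSLOCAL.
exact: decomposition_hard.
Qed.

Theorem theorem1p2 (k : nat) (k_gt0 : 0 < k) :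
  ((exists d0 c0 : nat -> nat, polylog d0 /\ polylog c0 /\
      forall d c : nat -> nat, polylog d -> polylog c ->
        (forall n, d0 n <= d n) -> (forall n, c0 n <= c n) ->
        PSLOCAL_complete k (weak_decomposition d c))
   /\ (forall d c : nat -> nat, polylog d -> polylog c ->
        PSLOCAL_hard k (weak_decomposition d c)))
  /\
  ((exists d0 c0 : nat -> nat, polylog d0 /\ polylog c0 /\
      forall d c : nat -> nat, polylog d -> polylog c ->
        (forall n, d0 n <= d n) -> (forall n, c0 n <= c n) ->
        PSLOCAL_complete k (strong_decomposition d c))
   /\ (forall d c : nat -> nat, polylog d -> polylog c ->
        PSLOCAL_hard k (strong_decomposition d c))).
Proof.
have strong_weak (G : sgraph) (C : {set G}) i j :
    i <= j -> strong_diam_le C i -> weak_diam_le C j.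
  move=> ij h u v uC vC; apply: dist_le_mono ij (h _ _ uC vC).
  exact: induced_subrel.
split; apply: decomposition_complete => //.
- by move=> G C m; apply: strong_weak.
- by move=> G C i j ij h u v uC vC; apply: dist_le_leq ij (h _ _ uC vC).
Qed.
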